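(* For every $n\ge5$, $$\mathrm{ex}(n,\mathbf A^+\mathbf B^+)=\binom{n-1}{2},$$ and the only extremal family is the full star, i.e. a triple system on $n$ vertices containing neither $\mathbf A^+$ nor $\mathbf B^+$ has $\binom{n-1}{2}$ triples if and only if it consists of all triples of the vertex set that contain some fixed vertex.
   Context: A triple system on a finite vertex set $V$, $|V|=n$, is a family of distinct $3$-element subsets (triples) of $V$. We write $123$ for $\{1,2,3\}$ etc. $\mathbf A^+$ is the triple system $\{123,124,135,236\}$ on the vertex set $\{1,\dots,6\}$, and $\mathbf B^+$ is the triple system $\{123,125,134,234\}$ on the vertex set $\{1,\dots,5\}$. A triple system contains a configuration if some of its triples form a system isomorphic to it (not necessarily induced). $\mathrm{ex}(n,\mathbf A^+\mathbf B^+)$ denotes the maximum number of triples in a triple system on $n$ vertices that contains neither $\mathbf A^+$ nor $\mathbf B^+$. A full star is the triple system of all triples of the vertex set containing a fixed vertex. *)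

(* Defs.v *)
From mathcomp Require Import all_boot.
Set Implicit Arguments.
Unset Strict Implicit.
Unset Printing Implicit Defensive.

Definition triple_system (V : finType) (F : {set {set V}}) : bool :=
  [forall e in F, #|e| == 3].

(* The vertices 1, ..., k+1 of a configuration are the elements 0, ..., k of
   'I_k.+1, so the vertex labelled a is inord a.-1. *)
Definition triple (k a b c : nat) : {set 'I_k.+1} :=
  [set inord a.-1; inord b.-1; inord c.-1].

Definition Aplus : {set {set 'I_6}} :=
  [set triple 5 1 2 3; triple 5 1 2 4; triple 5 1 3 5; triple 5 2 3 6].

Definition Bplus : {set {set 'I_5}} :=
  [set triple 4 1 2 3; triple 4 1 2 5; triple 4 1 3 4; triple 4 2 3 4].

(* Some triples of F form an isomorphic copy of C, which need not be induced. *)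
Definition contains (V W : finType) (F : {set {set V}}) (C : {set {set W}})
    : bool :=
  [exists f : {ffun W -> V},
     injectiveb f && ([set f @: e | e : {set W} in C] \subset F)].

Definition ABfree (V : finType) (F : {set {set V}}) : bool :=
  ~~ contains F Aplus && ~~ contains F Bplus.

Definition ex_AB (n : nat) : nat :=
  \max_(F : {set {set 'I_n}} | triple_system F && ABfree F) #|F|.

Definition full_star (V : finType) (v : V) : {set {set V}} :=
  [set e : {set V} | (#|e| == 3) && (v \in e)].

(* Main.v *)
Require Import Defs.
From mathcomp Require Import all_boot zify.

(** Call a pair of vertices of an edge [e] own if [e] is the only edge through
    it, and let n be the number of vertices.

    Avoiding both configurations says that whenever the three pairs of an edge
    abc extend to further edges abx, acy, bcz, the vertices x, y, z coincide:
    three distinct ones give the first configuration, exactly two equal ones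
    the second ([ABfree_extensions]).  An edge without an own pair therefore
    lies in a block, four vertices all of whose triples are edges, and applying
    the same fact to the other triples of the block shows that every edge
    meeting it in two vertices lies inside it ([ownerless_block]).  So each
    pair of a block is in exactly two edges.

    The bound is a weighted count of pairs, an instance of the proof of
    Bollobas' set pair inequality.  An edge with an own pair puts 2(n - 2) on
    one chosen own pair and 2 on each of its two other pairs, hence 2n in all;
    an edge without an own pair puts n - 2 on each of its pairs.  No pair
    receives more than 2(n - 2): an own pair is in one edge only, a pair of a
    block in two, and any other pair in at most n - 2 edges ([load_le]).  With
    G and B the numbers of edges of the two kinds,
    2n G + 3(n - 2) B <= 2(n - 2) binom(n, 2) = 2n binom(n - 1, 2).
    For n >= 7 one has 3(n - 2) > 2n, so the bound follows and is strict unless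
    B = 0.  For n = 5, 6, a block leaves at most two vertices outside, which
    bounds the number of edges by 4 and 8 directly ([block_small_bound]).

    In case of equality every edge has an own pair and every pair that is not
    chosen has codegree n - 2.  Let bc be the chosen pair of an edge abc.  Then
    ab and ac are in all possible edges.  For any other vertex z, the pair az
    is in both abz and acz, so it is not own either and is in all possible
    edges as well: the system contains the full star at a
    ([tight_full_star]). *)

Set Implicit Arguments.
Unset Strict Implicit.
Unset Printing Implicit Defensive.

(** * Consequences of avoiding the two configurations *)

Section Configurations.
Variables (V : finType) (F : {set {set V}}).

(** The vertex map of a would-be copy of a configuration, from the list of the
    images of its vertices in the order of their labels. *)
Definition embedding (k : nat) (x0 : V) (s : seq V) : {ffun 'I_k.+1 -> V} :=
  [ffun i : 'I_k.+1 => nth x0 s i].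

Lemma embedding_inj k x0 s :
  size s = k.+1 -> uniq s -> injectiveb (embedding k x0 s).
Proof.
move=> ss us; apply/injectiveP => i j; rewrite !ffunE => /eqP.
by rewrite nth_uniq ?ss // => /eqP/val_inj.
Qed.

Lemma imset_triple k (f : {ffun 'I_k.+1 -> V}) a b c :
  f @: triple k a b c = [set f (inord a.-1); f (inord b.-1); f (inord c.-1)].
Proof. by rewrite /triple !imsetU !imset_set1. Qed.

Lemma Aplus_contained a b c x y z :
  uniq [:: a; b; c; x; y; z] ->
  [set a; b; c] \in F -> [set a; b; x] \in F ->
  [set a; c; y] \in F -> [set b; c; z] \in F -> contains F Aplus.
Proof.
move=> us h1 h2 h3 h4; apply/existsP.
exists (embedding 5 a [:: a; b; c; x; y; z]).
rewrite embedding_inj //=; apply/subsetP => _ /imsetP[e eA ->].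
move: eA; rewrite !inE -!orbA.
by case/or4P => /eqP ->; rewrite imset_triple !ffunE !inordK.
Qed.

Lemma Bplus_contained a b c x y :
  uniq [:: a; b; c; x; y] ->
  [set a; b; c] \in F -> [set a; b; y] \in F ->
  [set a; c; x] \in F -> [set b; c; x] \in F -> contains F Bplus.
Proof.
move=> us h1 h2 h3 h4; apply/existsP.
exists (embedding 4 a [:: a; b; c; x; y]).
rewrite embedding_inj //=; apply/subsetP => _ /imsetP[e eA ->].
move: eA; rewrite !inE -!orbA.
by case/or4P => /eqP ->; rewrite imset_triple !ffunE !inordK.
Qed.

(** Stated with [perm_eq] because the hypothesis then amounts, for explicit lists,
    to an identity between counts that linear arithmetic decides. *)
Lemma perm_set3 (a b c x y z : V) :
  perm_eq [:: a; b; c] [:: x; y; z] -> [set a; b; c] = [set x; y; z].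
Proof.
by move/perm_mem => E; apply/setP => t; move: (E t); rewrite !inE !orbA.
Qed.

Lemma uniq_cat_notin (a b c : V) s t :
  uniq [:: a; b; c] -> perm_eq [:: a; b; c] s -> uniq t ->
  all (fun u => u \notin [set a; b; c]) t -> uniq (s ++ t).
Proof.
move=> us es ut /allP nt; rewrite cat_uniq -(perm_uniq es) us ut andbT /=.
by apply/hasPn => u /nt; rewrite /= -(perm_mem es) !inE !orbA.
Qed.

(** Three distinct extensions form the first configuration.  The second one is
    symmetric enough to cover each of the three ways in which exactly two of
    the extensions agree: its vertex 5 is the odd one out. *)
Lemma ABfree_extensions a b c x y z : ABfree F -> uniq [:: a; b; c] ->
  x \notin [set a; b; c] -> y \notin [set a; b; c] -> z \notin [set a; b; c] ->
  [set a; b; c] \in F -> [set a; b; x] \in F ->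
  [set a; c; y] \in F -> [set b; c; z] \in F -> x = y /\ y = z.
Proof.
case/andP=> nA nB u3 nx ny nz Fabc Fx Fy Fz.
have noB p q r s t :
    [set p; q; r] \in F -> [set p; q; t] \in F ->
    [set p; r; s] \in F -> [set q; r; s] \in F ->
    perm_eq [:: a; b; c] [:: p; q; r] ->
    s \notin [set a; b; c] -> t \notin [set a; b; c] -> s = t.
  move=> h1 h2 h3 h4 E ns nt; apply: contraNeq nB => st.
  apply: (@Bplus_contained p q r s t) => //.
  apply: (@uniq_cat_notin a b c [:: p; q; r] [:: s; t]) => //=.
    by rewrite inE st.
  by rewrite ns nt.
have swap p q r : [set p; q; r] \in F -> [set q; p; r] \in F.
  by rewrite (@perm_set3 p q r q p r) //; apply/permP => P /=; lia.
have rot p q r : [set p; q; r] \in F -> [set q; r; p] \in F.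
  by rewrite (@perm_set3 p q r q r p) //; apply/permP => P /=; lia.
case: (eqVneq x y) => [exy|nxy]; case: (eqVneq y z) => [eyz|nyz] //.
- subst y; case/eqP: nyz.
  apply: (noB b c a x z) => //; [exact/rot | exact/swap | exact/swap | ].
  by apply/permP => P /=; lia.
- subst z; case/eqP: nxy; apply/esym.
  exact: (noB a b c y x).
- case: (eqVneq x z) => [exz|nxz].
  + subst z; case/eqP: nyz; apply/esym.
    apply: (noB a c b x y) => //; [exact/rot/swap | exact/swap | ].
    by apply/permP => P /=; lia.
  + case/negP: nA; apply: (@Aplus_contained a b c x y z) => //.
    apply: (@uniq_cat_notin a b c [:: a; b; c] [:: x; y; z]) => //=.
      by rewrite !inE negb_or nxy nxz nyz.
    by rewrite nx ny nz.
Qed.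
End Configurations.

(** * Own pairs and blocks *)

Section Blocks.
Variables (V : finType) (F : {set {set V}}).

Definition own_pair (e P : {set V}) : bool :=
  [&& P \subset e, #|P| == 2 & [forall f in F, (P \subset f) ==> (f == e)]].

Definition has_own_pair (e : {set V}) : bool := [exists P, own_pair e P].

Definition isolated_block (K : {set V}) : Prop :=
  [/\ #|K| = 4,
      forall A : {set V}, A \subset K -> #|A| = 3 -> A \in F &
      forall f, f \in F -> 1 < #|f :&: K| -> f \subset K].

Lemma card_set3 (a b c : V) : uniq [:: a; b; c] -> #|[set a; b; c]| = 3.
Proof. by move=> u; rewrite -[3](card_uniqP u); apply: eq_card => t; rewrite !inE orbA. Qed.

Lemma card3_pairE (e : {set V}) a b : #|e| = 3 -> a \in e -> b \in e ->
  a != b -> exists2 c, uniq [:: a; b; c] & e = [set a; b; c].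
Proof.
move=> e3 ae be ab; have abe : [set a; b] \subset e.
  by apply/subsetP => t; rewrite !inE => /orP[] /eqP ->.
have : #|e :\: [set a; b]| == 1 by rewrite cardsDS // e3 cards2 ab.
case/cards1P => c ec; exists c.
  have : c \in e :\: [set a; b] by rewrite ec set11.
  by rewrite /= !inE !negb_or ab (eq_sym a c) (eq_sym b c) => /andP[/andP[-> ->]].
by rewrite -(setID e [set a; b]) ec; move/setIidPr: abe => ->.
Qed.

Hypothesis F3 : triple_system F.

Lemma triple_system_card e : e \in F -> #|e| = 3.
Proof. by move=> eF; move/forall_inP: F3 => /(_ e eF)/eqP. Qed.

Lemma not_own_extension a b c : uniq [:: a; b; c] -> [set a; b; c] \in F ->
  ~~ own_pair [set a; b; c] [set a; b] ->
  exists2 x, x \notin [set a; b; c] & [set a; b; x] \in F.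
Proof.
move=> u Fe; have ab : a != b by move: u; rewrite /= !inE negb_or -andbA => /and3P[].
rewrite /own_pair subsetUl cards2 ab /= => /forall_inPn[f fF].
rewrite negb_imply => /andP[/subsetP sf nf].
have [x ux ef] := card3_pairE (triple_system_card fF) (sf _ (set21 a b)) (sf _ (set22 a b)) ab.
subst f; exists x => //; rewrite !inE !negb_or.
move: ux; rewrite /= !inE !negb_or -!andbA => /and4P[_ ax bx _].
rewrite (eq_sym x a) (eq_sym x b) ax bx /=.
by apply: contra nf => /eqP ->.
Qed.

(** Let ab be in K, let c and d be the other vertices of K, and let s be a
    further extension of ab.  The edge abc has the extensions s on ab and d on
    ac and bc, so s = d. *)
Lemma isolated_blockI (K : {set V}) : ABfree F -> #|K| = 4 ->
  (forall A : {set V}, A \subset K -> #|A| = 3 -> A \in F) -> isolated_block K.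
Proof.
move=> free K4 KF; split=> // f fF /card_gt1P[a [b []]].
rewrite !inE => /andP[af aK] /andP[bf bK] ab.
have [s us ef] := card3_pairE (triple_system_card fF) af bf ab.
have abK : [set a; b] \subset K.
  by apply/subsetP => t; rewrite !inE => /orP[] /eqP ->.
have : #|K :\: [set a; b]| == 2 by rewrite cardsDS // K4 cards2 ab.
case/cards2P=> c [d [cd ecd]].
have eK t : (t \in K) = [|| t == a, t == b, t == c | t == d].
  move/setP/(_ t): ecd; rewrite !inE.
  by case: eqP => [->|_]; case: eqP => [->|_]; rewrite ?aK ?bK //= .
have : c \in K :\: [set a; b] by rewrite ecd !inE eqxx.
have : d \in K :\: [set a; b] by rewrite ecd !inE eqxx orbT.
rewrite !inE !negb_or => /andP[/andP[da db] dK] /andP[/andP[ca cb] cK].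
rewrite ef; apply/subsetP => t; rewrite !inE -orbA => /or3P[] /eqP-> //.
have uabc : uniq [:: a; b; c] by rewrite /= !inE negb_or ab (eq_sym a) (eq_sym b) ca cb.
have [sc|sc] := eqVneq s c; first by rewrite sc.
suff [-> _] : s = d /\ d = d by [].
have KF3 p q r : p \in K -> q \in K -> r \in K -> uniq [:: p; q; r] -> [set p; q; r] \in F.
  move=> pK qK rK u; apply: KF (card_set3 u).
  by apply/subsetP => v; rewrite !inE -orbA => /or3P[] /eqP->.
have dabc : d \notin [set a; b; c] by rewrite !inE !negb_or da db eq_sym cd.
have sabc : s \notin [set a; b; c].
  move: us; rewrite /= !inE !negb_or -!andbA => /and4P[_ sa sb _].
  by rewrite (eq_sym s a) sa (eq_sym s b) sb sc.
apply: (ABfree_extensions free uabc) => //.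
- exact: KF3.
- by rewrite -ef.
- by apply: KF3; rewrite //= !inE negb_or cd (eq_sym a) ca (eq_sym a) da.
- by apply: KF3; rewrite //= !inE negb_or cd (eq_sym b) cb (eq_sym b) db.
Qed.

Lemma card3P (e : {set V}) : #|e| = 3 ->
  exists a b c, uniq [:: a; b; c] /\ e = [set a; b; c].
Proof.
move=> e3; have /card_gt1P[a [b [ae be ab]]] : 1 < #|e| by rewrite e3.
by have [c u ->] := card3_pairE e3 ae be ab; exists a, b, c.
Qed.

(** As no pair of [e] is own, each of them extends to another edge.  The three
    extensions agree in one vertex [x], and [x |: e] is the block. *)
Lemma ownerless_block e : ABfree F -> e \in F -> ~~ has_own_pair e ->
  exists2 K : {set V}, e \subset K & isolated_block K.
Proof.
move=> free eF /existsPn no.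
have [a [b [c [u ee]]]] := card3P (triple_system_card eF); subst e.
have [x nx Fx] := not_own_extension u eF (no _).
have Eacb : [set a; b; c] = [set a; c; b].
  by apply/perm_set3/permP => P /=; lia.
have Ebca : [set a; b; c] = [set b; c; a].
  by apply/perm_set3/permP => P /=; lia.
have uacb : uniq [:: a; c; b].
  by rewrite (perm_uniq (_ : perm_eq _ [:: a; b; c])) //; apply/permP => P /=; lia.
have ubca : uniq [:: b; c; a].
  by rewrite (perm_uniq (_ : perm_eq _ [:: a; b; c])) //; apply/permP => P /=; lia.
have [y ny Fy] : exists2 y, y \notin [set a; b; c] & [set a; c; y] \in F.
  by rewrite Eacb; apply: not_own_extension; rewrite // -?Eacb.
have [z nz Fz] : exists2 z, z \notin [set a; b; c] & [set b; c; z] \in F.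
  by rewrite Ebca; apply: not_own_extension; rewrite // -?Ebca.
have [exy eyz] := ABfree_extensions free u nx ny nz eF Fx Fy Fz; subst y z.
exists (x |: [set a; b; c]); first exact: subsetUr.
have K4 : #|x |: [set a; b; c]| = 4 by rewrite cardsU1 nx card_set3.
apply: isolated_blockI => // A AK A3.
have : #|(x |: [set a; b; c]) :\: A| == 1 by rewrite cardsDS // K4 A3.
case/cards1P => t Et.
have -> : A = (x |: [set a; b; c]) :\ t.
  by rewrite -Et setDDr setDv set0U; apply/esym/setIidPr.
have : t \in x |: [set a; b; c] by move/setP/(_ t): Et; rewrite !inE eqxx => /andP[].
move: nx u; rewrite !inE !negb_or /= !inE !negb_or -!andbA -!orbA => /and3P[xa xb xc] /and4P[ab ac bc _].
case/or4P => /eqP ->.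
- by rewrite setU1K.
- rewrite (_ : _ :\ a = [set b; c; x]) //.
  apply/setP => v; rewrite !inE; case: (eqVneq v a) => [->|_]; last by do 3 case: (v == _).
  by rewrite (negbTE ab) (negbTE ac) (eq_sym a) (negbTE xa).
- rewrite (_ : _ :\ b = [set a; c; x]) //.
  apply/setP => v; rewrite !inE; case: (eqVneq v b) => [->|_]; last by do 3 case: (v == _).
  by rewrite (eq_sym b a) (negbTE ab) (negbTE bc) (eq_sym b) (negbTE xb).
- rewrite (_ : _ :\ c = [set a; b; x]) //.
  apply/setP => v; rewrite !inE; case: (eqVneq v c) => [->|_]; last by do 3 case: (v == _).
  by rewrite !(eq_sym c) (negbTE ac) (negbTE bc) (negbTE xc).
Qed.

(** An edge through [P] lies in [K], so its third vertex is one of the two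
    vertices of [K] outside [P], and both choices give edges. *)
Lemma block_pair_edges (K P : {set V}) : isolated_block K -> P \subset K -> #|P| = 2 ->
  #|[set f in F | P \subset f]| = 2 /\
  forall f, f \in F -> P \subset f -> f \subset K.
Proof.
case=> K4 KF Kiso PK P2.
have fK f : f \in F -> P \subset f -> f \subset K.
  move=> fF Pf; apply: Kiso => //; rewrite -P2.
  by apply: subset_leq_card; rewrite subsetI Pf.
split=> //.
have : #|K :\: P| == 2 by rewrite cardsDS // K4 P2.
case/cards2P=> c [d [cd ecd]].
have [cP cK] : c \notin P /\ c \in K by apply/andP; move/setP/(_ c): ecd; rewrite !inE eqxx => ->.
have [dP dK] : d \notin P /\ d \in K by apply/andP; move/setP/(_ d): ecd; rewrite !inE eqxx orbT => ->.
have ->: [set f in F | P \subset f] = [set c |: P; d |: P].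
  apply/setP => f; rewrite !inE; apply/andP/orP => [[fF Pf]|].
    have : #|f :\: P| == 1 by rewrite cardsDS // P2 triple_system_card.
    case/cards1P => t Et.
    have : t \in f :\: P by rewrite Et set11.
    rewrite inE => /andP[tP tf]; have tK := subsetP (fK _ fF Pf) t tf.
    have Ef : f = t |: P by rewrite -[LHS](setID f P) Et setUC (setIidPr Pf).
    have : t \in K :\: P by rewrite inE tP.
    by rewrite ecd !inE Ef => /orP[] /eqP ->; [left | right].
  by case=> /eqP ->; rewrite subsetUr; split=> //; apply: KF;
    rewrite ?subUset ?sub1set ?cK ?dK ?PK // cardsU1 P2 ?cP ?dP.
rewrite cards2 (_ : c |: P != d |: P) //.
apply/eqP => /setP/(_ c); rewrite !inE eqxx (negbTE cP) (negbTE cd) //.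
Qed.

Lemma block_ownerless (K f : {set V}) : isolated_block K -> f \in F -> f \subset K ->
  ~~ has_own_pair f.
Proof.
move=> bK fF fK; apply/existsPn => P; apply/negP => /and3P[Pf /eqP P2 /forall_inP own].
have [c2 _] := block_pair_edges bK (subset_trans Pf fK) P2.
suff : 2 <= #|[set f]| by rewrite cards1.
rewrite -c2; apply/subset_leq_card/subsetP => g; rewrite !inE => /andP[gF Pg].
exact: (implyP (own g gF)).
Qed.
End Blocks.

(** * Weighted count of pairs *)

Section Counting.
Variables (V : finType) (F : {set {set V}}).
Hypothesis F3 : triple_system F.
Hypothesis free : ABfree F.

Notation n := #|V|.

Definition edges_through (P : {set V}) : {set {set V}} := [set f in F | P \subset f].

Definition triples_through (P : {set V}) : {set {set V}} := [set z |: P | z in ~: P].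

Lemma card_triples_through (P : {set V}) : #|P| = 2 -> #|triples_through P| = n - 2.
Proof.
move=> P2; rewrite card_in_imset; first by rewrite cardsCs setCK P2.
move=> y z; rewrite !inE => yP zP /setP/(_ y).
by rewrite !inE eqxx (negbTE yP) /= orbF => /esym/eqP.
Qed.

Lemma edges_through_sub (P : {set V}) : #|P| = 2 -> edges_through P \subset triples_through P.
Proof.
move=> P2; apply/subsetP => f; rewrite inE => /andP[fF Pf].
have : #|f :\: P| == 1 by rewrite cardsDS // P2 (triple_system_card F3).
case/cards1P => t Et; apply/imsetP; exists t.
  have : t \in f :\: P by rewrite Et set11.
  by rewrite !inE => /andP[].
by rewrite -[LHS](setID f P) Et setUC (setIidPr Pf).
Qed.

Lemma codegree_leqif (P : {set V}) :
  #|P| = 2 -> #|edges_through P| <= n - 2 ?= iff (edges_through P == triples_through P).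
Proof.
by move=> P2; rewrite -(card_triples_through P2); apply/subset_leqif_cards/edges_through_sub.
Qed.

(** An edge may have several own pairs; fixing one of them makes the total weight
    of an edge independent of their number. *)
Definition chosen_pair (e : {set V}) : {set V} :=
  odflt set0 [pick P | own_pair F e P].

Lemma chosen_pairP e : has_own_pair F e -> own_pair F e (chosen_pair e).
Proof.
by case/existsP=> P; rewrite /chosen_pair; case: pickP => //= ->.
Qed.

Lemma own_pair_inj e f P : f \in F -> own_pair F e P -> P \subset f -> f = e.
Proof. by move=> fF /and3P[_ _ /forall_inP /(_ f fF) /implyP h] /h /eqP. Qed.

(** The weights are twice the natural ones, since a pair in a block is shared by
    two edges, each entitled to half of its capacity. *)
Definition weight (e P : {set V}) : nat :=
  if has_own_pair F e then (if P == chosen_pair e then 2 * (n - 2) else 2)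
  else n - 2.

Definition pairs : {set {set V}} := [set P : {set V} | #|P| == 2].

Definition load (P : {set V}) : nat := \sum_(e in edges_through P) weight e P.

Lemma load_unchosen (P : {set V}) :
  (forall e, e \in edges_through P -> has_own_pair F e && (P != chosen_pair e)) ->
  load P = 2 * #|edges_through P|.
Proof.
move=> h; rewrite /load mulnC -sum_nat_const; apply: eq_bigr => e /h.
by rewrite /weight => /andP[-> /negbTE ->].
Qed.

(** The edges through [P] are of a single kind: only one edge if [P] is chosen,
    two edges without own pair if one of them has none, and otherwise at most
    n - 2 edges that each put 2 on [P]. *)
Lemma load_le (P : {set V}) : P \in pairs -> load P <= 2 * (n - 2).
Proof.
rewrite inE => /eqP P2.
case: (pickP [pred e in edges_through P | ~~ (has_own_pair F e && (P != chosen_pair e))]).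
  move=> e /=; rewrite inE => /andP[/andP[eF Pe]].
  case: (boolP (has_own_pair F e)) => [he /= /negPn/eqP Pc|no _]; last first.
    have [K eK bK] := ownerless_block F3 free eF no.
    have [c2 sK] := block_pair_edges F3 bK (subset_trans Pe eK) P2.
    apply: (@leq_trans (#|edges_through P| * (n - 2))); last by rewrite /edges_through c2.
    rewrite -sum_nat_const.
    apply: leq_sum => f; rewrite inE => /andP[fF Pf]; rewrite /weight.
    by rewrite (negbTE (block_ownerless F3 bK fF (sK _ fF Pf))).
  have oP := chosen_pairP he; rewrite -Pc in oP.
  rewrite /load (big_pred1 e) /= ?/weight ?he -?Pc ?eqxx // => f.
  rewrite inE; apply/andP/eqP => [[fF Pf]|->]; first exact: own_pair_inj oP Pf.
  by split.
move=> h; rewrite load_unchosen; last first.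
  by move=> e el; move: (h e); rewrite /= el /= => /negbFE.
by rewrite leq_mul2l /= (codegree_leqif P2).
Qed.

Lemma card_pairs_in (e : {set V}) : #|e| = 3 -> #|[set P in pairs | P \subset e]| = 3.
Proof.
move=> e3; transitivity 'C(#|e|, 2); last by rewrite e3.
by rewrite -cards_draws; apply: eq_card => P; rewrite !inE andbC.
Qed.

Lemma sum_weight e : e \in F ->
  \sum_(P in pairs | P \subset e) weight e P =
    if has_own_pair F e then 2 * n else 3 * (n - 2).
Proof.
move=> eF; have e3 := triple_system_card F3 eF.
have n3 : 3 <= n by rewrite -e3 max_card.
rewrite /weight; case: ifP => [he|_]; last first.
  rewrite (eq_bigl (mem [set P in pairs | P \subset e])); last by move=> P; rewrite !inE.
  by rewrite sum_nat_const card_pairs_in.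
have /and3P[ce c2 _] := chosen_pairP he.
rewrite (bigD1 (chosen_pair e)) /=; last by rewrite inE c2.
rewrite eqxx (eq_bigr (fun=> 2)); last by move=> P /andP[_ /negbTE ->].
rewrite (eq_bigl (mem ([set P in pairs | P \subset e] :\ chosen_pair e))); last first.
  by move=> P; rewrite !inE andbC.
have := cardsD1 (chosen_pair e) [set P in pairs | P \subset e].
rewrite card_pairs_in // 2!inE c2 ce /= => -[/esym c3].
rewrite add0n in c3.
rewrite sum_nat_const c3.
move: n3; move: #|V| => m; lia.
Qed.

Definition owners : {set {set V}} := [set e in F | has_own_pair F e].
Definition ownerless : {set {set V}} := [set e in F | ~~ has_own_pair F e].

Lemma card_owners : #|owners| + #|ownerless| = #|F|.
Proof.
rewrite -(cardsID [set e | has_own_pair F e] F); congr (_ + _);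
  by apply: eq_card => e; rewrite !inE // andbC.
Qed.

Lemma sum_load :
  \sum_(P in pairs) load P = #|owners| * (2 * n) + #|ownerless| * (3 * (n - 2)).
Proof.
rewrite /load (exchange_big_dep (mem F)) /=; last by move=> P e _; rewrite inE => /andP[].
transitivity (\sum_(e in F) if has_own_pair F e then 2 * n else 3 * (n - 2)).
  apply: eq_bigr => e eF; rewrite -sum_weight //.
  by apply: eq_bigl => P; rewrite !inE eF.
rewrite big_if /= -!sum_nat_const; congr (_ + _); apply: eq_bigl => e;
  by rewrite inE.
Qed.

Lemma capacity : 5 <= n -> \sum_(P in pairs) 2 * (n - 2) = 'C(n - 1, 2) * (2 * n).
Proof.
move=> n5; rewrite sum_nat_const card_draws.
have := mul_bin_down n 2; rewrite -subn1; lia.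
Qed.

Lemma owners_bound : 5 <= n ->
  #|owners| * (2 * n) + #|ownerless| * (3 * (n - 2)) <= 'C(n - 1, 2) * (2 * n).
Proof.
by move=> n5; rewrite -sum_load -capacity //; apply: leq_sum => P; apply: load_le.
Qed.

(** Outside a block there are n - 4 <= 2 vertices, so an edge not inside the
    block, which meets it in at most one vertex, contains all of them and exists
    only for n = 6.  Hence an edge is determined by its trace on the block,
    which has 3 vertices or, for n = 6, possibly 1. *)
Lemma block_small_bound (K : {set V}) : isolated_block F K -> 5 <= n <= 6 ->
  #|F| < 'C(n - 1, 2).
Proof.
case=> K4 KF Kiso /andP[n5 n6].
have KC : #|~: K| = n - 4 by rewrite cardsCs setCK K4.
have dich f : f \in F -> f \subset K \/ n = 6 /\ #|f :&: K| = 1 /\ f = (~: K) :|: (f :&: K).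
  move=> fF; case: (leqP 2 #|f :&: K|) => [/(Kiso f fF)|le1]; [by left | right].
  have f3 := triple_system_card F3 fF.
  have := cardsID K f; rewrite f3 => fID.
  have sD : f :\: K \subset ~: K by rewrite setDE subsetIr.
  have := subset_leq_card sD; rewrite KC => leD.
  have ED : f :\: K = ~: K by apply/eqP; rewrite eqEcard sD KC; lia.
  have D2 : #|f :\: K| = n - 4 by rewrite ED.
  split; first lia; split; first lia.
  by rewrite -[LHS](setID f K) setUC ED.
pose T k := [set A : {set V} | A \subset K & #|A| == k].
have cT k : #|T k| = 'C(4, k) by rewrite -K4 cards_draws.
have inj : {in F &, injective (fun f => f :&: K)}.
  move=> f g fF gF E.
  case: (dich f fF) (dich g gF) => [fK|[_ [f1 ->]]] [gK|[_ [g1 ->]]].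
  - by rewrite -(setIidPl fK) E (setIidPl gK).
  - by move: g1; rewrite -E (setIidPl fK) (triple_system_card F3 fF).
  - by move: f1; rewrite E (setIidPl gK) (triple_system_card F3 gF).
  - by rewrite E.
rewrite -(card_in_imset inj).
case: (eqVneq n 6) => [n66|n6'].
  apply: (@leq_ltn_trans #|T 3 :|: T 1|); last first.
    by rewrite (leq_ltn_trans (leq_card_setU _ _)) // !cT n66.
  apply/subset_leq_card/subsetP => _ /imsetP[f fF ->]; rewrite !inE subsetIr /=.
  case: (dich f fF) => [fK|[_ [-> _]]]; last by rewrite orbT.
  by rewrite (setIidPl fK) (triple_system_card F3 fF).
have n55 : n = 5 by lia.
apply: (@leq_ltn_trans #|T 3|); last by rewrite cT n55.
apply/subset_leq_card/subsetP => _ /imsetP[f fF ->]; rewrite !inE subsetIr /=.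
case: (dich f fF) => [fK|[n66 _]]; last by rewrite n66 in n6'.
by rewrite (setIidPl fK) (triple_system_card F3 fF).
Qed.

(** For n >= 7 the weight 3(n - 2) of an edge without own pair exceeds the weight
    2n of the others, so one such edge makes the count strict. *)
Lemma ownerless_lt e : 5 <= n -> e \in ownerless -> #|F| < 'C(n - 1, 2).
Proof.
move=> n5 eB; case: (leqP n 6) => [n6|n7].
  move: eB; rewrite inE => /andP[eF no].
  have [K _ bK] := ownerless_block F3 free eF no.
  by apply: block_small_bound bK _; rewrite n5.
have := owners_bound n5; rewrite -card_owners.
have : 0 < #|ownerless| by apply/card_gt0P; exists e.
by move: 'C(_, _) => C; nia.
Qed.

Lemma ABfree_card_le : 5 <= n -> #|F| <= 'C(n - 1, 2).
Proof.
move=> n5; case: (set_0Vmem ownerless) => [B0|[e eB]]; last exact/ltnW/(ownerless_lt n5 eB).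
have := owners_bound n5; rewrite -card_owners B0 cards0 !addn0 leq_pmul2r //; lia.
Qed.

Lemma tight_load : 5 <= n -> #|F| = 'C(n - 1, 2) ->
  forall P, P \in pairs -> load P = 2 * (n - 2).
Proof.
move=> n5 FC.
have B0 : ownerless = set0.
  case: (set_0Vmem ownerless) => [//|[e eB]].
  by move: (ownerless_lt n5 eB); rewrite FC ltnn.
have : \sum_(P in pairs) load P <= \sum_(P in pairs) 2 * (n - 2)
    ?= iff [forall (P | P \in pairs), load P == 2 * (n - 2)].
  by apply: leqif_sum => P PP; apply/leqif_eq/load_le.
rewrite sum_load capacity // -FC -card_owners B0 cards0 !addn0 => /eq_leqif.
by rewrite eqxx => /esym/forall_inP h P /h /eqP.
Qed.

(** The centre of the star is the vertex of an edge outside its chosen pair. *)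
Lemma tight_full_star : 5 <= n -> #|F| = 'C(n - 1, 2) -> exists v, full_star v \subset F.
Proof.
move=> n5 FC.
have allown e : e \in F -> has_own_pair F e.
  move=> eF; case: (boolP (has_own_pair F e)) => // no; have : e \in ownerless by rewrite inE eF.
  by move/(ownerless_lt n5); rewrite FC ltnn.
(* A pair that no edge has chosen reaches its capacity only by being in all
   possible edges. *)
have full (P : {set V}) z : #|P| = 2 -> (forall e, e \in F -> P != chosen_pair e) -> z \notin P ->
    z |: P \in F.
  move=> P2 nc zP.
  have Pp : P \in pairs by rewrite inE P2.
  have zf : z |: P \in triples_through P by apply: imset_f; rewrite inE.
  have := tight_load n5 FC Pp; rewrite load_unchosen => [/eqP|e]; last first.
    by rewrite inE => /andP[eF _]; rewrite allown ?nc.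
  rewrite eqn_pmul2l // (eq_leqif (codegree_leqif P2)) => /eqP E.
  by move: zf; rewrite -E inE => /andP[].
have [e eF] : exists e, e \in F.
  apply/card_gt0P; rewrite FC bin_gt0; lia.
have oe := chosen_pairP (allown e eF); have /and3P[ce /cards2P[b [c [bc Ec]]] _] := oe.
have e3 := triple_system_card F3 eF.
have be : b \in e by apply: (subsetP ce); rewrite Ec set21.
have c_e : c \in e by apply: (subsetP ce); rewrite Ec set22.
have [a u Ee] := card3_pairE e3 be c_e bc.
move: u; rewrite /= !inE !negb_or -!andbA => /and4P[_ ba ca _].
have unchosen (P : {set V}) : P \subset e -> P != chosen_pair e -> forall f, f \in F -> P != chosen_pair f.
  move=> Pe Pne f fF; apply/eqP => Pf; case/eqP: Pne.
  have oP : own_pair F f P by rewrite Pf; apply/chosen_pairP/allown.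
  by rewrite (own_pair_inj eF oP Pe).
(* ab and ac cannot be chosen by another edge than abc, which has chosen bc. *)
have a_full x z : (x == b) || (x == c) -> z != a -> z != x -> [set a; x; z] \in F.
  move=> xbc za zx; have ax : a != x by case/orP: xbc => /eqP ->; rewrite eq_sym.
  rewrite setUC; apply: full; first by rewrite cards2 ax.
    apply: unchosen.
      apply/subsetP => t; rewrite Ee !inE => /orP[] /eqP -> ; first by rewrite eqxx !orbT.
      by case/orP: xbc => ->; rewrite ?orbT.
    by apply/eqP => /setP/(_ a); rewrite Ec !inE eqxx !(eq_sym a) (negbTE ba) (negbTE ca).
  by rewrite !inE negb_or za zx.
(* az is in the two edges abz and acz, so no edge owns it. *)
have az_full z t : z != a -> t != a -> t != z -> [set a; z; t] \in F.
  move=> za ta tz; case: (boolP ((z == b) || (z == c))) => [zbc|]; first exact: a_full.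
  rewrite negb_or => /andP[zb zc].
  rewrite setUC; apply: full.
  - by rewrite cards2 eq_sym za.
  - move=> f fF; apply/eqP => Ef.
    have of_ := chosen_pairP (allown f fF); rewrite -Ef in of_.
    have Fbz : [set a; b; z] \in F by apply: a_full; rewrite ?eqxx.
    have Fcz : [set a; c; z] \in F by apply: a_full; rewrite ?eqxx ?orbT.
    have s x : [set a; z] \subset [set a; x; z].
      by apply/subsetP => y; rewrite !inE => /orP[] ->; rewrite ?orbT.
    have := own_pair_inj Fbz of_ (s b); rewrite -(own_pair_inj Fcz of_ (s c)).
    move/setP/(_ b); rewrite !inE eqxx (negbTE ba) (negbTE bc) (eq_sym b) (negbTE zb).
    by [].
  - by rewrite !inE negb_or ta tz.
exists a; apply/subsetP => f; rewrite inE => /andP[/eqP f3 af].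
have /card_gt1P[x [y [xf yf xy]]] : 1 < #|f| by rewrite f3.
have [z zf za] : exists2 z, z \in f & z != a.
  by case: (eqVneq x a) => [xa|xa]; [exists y; rewrite // -xa eq_sym | exists x].
have az : a != z by rewrite eq_sym.
have [t u ->] := card3_pairE f3 af zf az.
move: u; rewrite /= !inE !negb_or -!andbA => /and4P[_ at_ zt _].
by apply: az_full; rewrite // eq_sym.
Qed.

End Counting.

(** * Full stars *)

(** Deleting [v] maps the star bijectively onto the pairs avoiding [v]. *)
Lemma card_full_star (V : finType) (v : V) : #|full_star v| = 'C(#|V| - 1, 2).
Proof.
rewrite -(card_in_imset (f := fun e => e :\ v)).
  have -> : #|V| - 1 = #|[set~ v]| by rewrite cardsC1 subn1.
  rewrite -cards_draws; apply: eq_card => A; rewrite inE.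
  apply/imsetP/andP => [[e]|[Av /eqP A2]].
    rewrite inE => /andP[/eqP e3 ve] ->.
    split; first by rewrite setDE subsetIr.
    by have := cardsD1 v e; rewrite e3 ve add1n => -[<-].
  have nv : v \notin A by apply/negP => /(subsetP Av); rewrite !inE eqxx.
  exists (v |: A); last by rewrite setU1K.
  by rewrite inE cardsU1 nv A2 setU11.
move=> e f; rewrite !inE => /andP[_ ve] /andP[_ vf] E.
by rewrite -(setD1K ve) E setD1K.
Qed.

Lemma triple_system_full_star (V : finType) (v : V) : triple_system (full_star v).
Proof. by apply/forall_inP => e; rewrite inE => /andP[]. Qed.

(** In a copy of [C] inside a star, the centre would be the image of a vertex
    common to all members of [C]. *)
Lemma full_star_noncontains (V W : finType) (v : V) (C : {set {set W}}) :
  (forall w, exists2 e, e \in C & w \notin e) -> C != set0 ->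
  ~~ contains (full_star v) C.
Proof.
move=> h /set0Pn[e0 e0C]; apply/existsPn => f; apply/negP => /andP[/injectiveP inj /subsetP s].
have st e : e \in C -> v \in f @: e.
  by move=> eC; move: (s _ (imset_f _ eC)); rewrite inE => /andP[].
have /imsetP[w _ vw] := st _ e0C.
have [e eC] := h w; rewrite -(mem_imset e w inj) -vw; by rewrite st.
Qed.

Lemma ABfree_full_star (V : finType) (v : V) : ABfree (full_star v).
Proof.
have inordE k i (w : 'I_k.+1) : i <= k -> (w == inord i) = (w == i :> nat).
  by move=> ik; rewrite -val_eqE /= inordK.
apply/andP; split; apply: full_star_noncontains.
(* A common vertex would be one of the labels 1, 2, 3 of the first triple, and
   each of them is missed by another triple. *)
- move=> w; case: (boolP (w \in triple 5 1 2 3)) => [|]; last first.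
    by exists (triple 5 1 2 3); rewrite // !inE eqxx.
  rewrite !inE !inordE //= -orbA => /or3P[] /eqP w_.
  + by exists (triple 5 2 3 6); rewrite !inE ?eqxx ?orbT // !inordE // w_.
  + by exists (triple 5 1 3 5); rewrite !inE ?eqxx ?orbT // !inordE // w_.
  + by exists (triple 5 1 2 4); rewrite !inE ?eqxx ?orbT // !inordE // w_.
- by apply/set0Pn; exists (triple 5 1 2 3); rewrite !inE eqxx.
- move=> w; case: (boolP (w \in triple 4 1 2 3)) => [|]; last first.
    by exists (triple 4 1 2 3); rewrite // !inE eqxx.
  rewrite !inE !inordE //= -orbA => /or3P[] /eqP w_.
  + by exists (triple 4 2 3 4); rewrite !inE ?eqxx ?orbT // !inordE // w_.
  + by exists (triple 4 1 3 4); rewrite !inE ?eqxx ?orbT // !inordE // w_.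
  + by exists (triple 4 1 2 5); rewrite !inE ?eqxx ?orbT // !inordE // w_.
- by apply/set0Pn; exists (triple 4 1 2 3); rewrite !inE eqxx.
Qed.

Theorem theorem2 (n : nat) (hn : 5 <= n) :
  ex_AB n = 'C(n - 1, 2) /\
  forall (V : finType) (F : {set {set V}}),
    #|V| = n -> triple_system F -> ABfree F ->
    (#|F| = 'C(n - 1, 2) <-> exists v : V, F = full_star v).
Proof.
split.
  have v : 'I_n by exists 0; apply: leq_trans hn.
  apply/eqP; rewrite /ex_AB eqn_leq; apply/andP; split.
    apply/bigmax_leqP => F /andP[F3 free].
    by have := @ABfree_card_le _ F F3 free; rewrite card_ord; apply.
  have <- : #|full_star v| = 'C(n - 1, 2) by rewrite card_full_star card_ord.
  apply: leq_bigmax_cond.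
  by rewrite triple_system_full_star ABfree_full_star.
move=> V F Vn F3 free; subst n; split=> [FC|[v ->]]; last exact: card_full_star.
have [v sv] := tight_full_star F3 free hn FC.
by exists v; apply/esym/eqP; rewrite eqEcard sv FC card_full_star /=.
Qed.
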